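(* Let $\mathcal L$ be a one-dimensional skip-free semi-irreducible MMRRW ($d=1$, $D=\{1\}$) with irreducible class $\mathcal S_0$ such that $(\{0\}\times S^\emptyset)\cap\mathcal S_0\neq\emptyset$ and such that its induced Markov chain $\mathcal L^D$ (a finite Markov chain) is semi-irreducible. Let $a^D$ be its mean drift. Then $\mathcal L$ is stable if $a^D<0$, and it is unstable if $a^D>0$.
   Context: One-dimensional MMRRW. Let $S^\emptyset$ and $S^{\{1\}}$ be nonempty finite sets. A one-dimensional skip-free Markov modulated reflecting random walk (MMRRW) $\mathcal L=\{(X_n,J_n)\}$ is a discrete-time homogeneous Markov chain on $\mathcal S=(\{0\}\times S^\emptyset)\cup(\{1,2,\dots\}\times S^{\{1\}})$ whose transition matrix is block tri-diagonal with blocks indexed by the level $X_n$: from level $0$ the blocks are $P_0^{\emptyset,\emptyset}$ (to level $0$) and $P_1^{\emptyset,\{1\}}$ (to level $1$); from level $1$ they are $P_{-1}^{\{1\},\emptyset}$ (to level $0$), $P_0^{\{1\},\{1\}}$, $P_1^{\{1\},\{1\}}$ (to levels $1$, $2$); from level $x\ge2$ they are $P_{-1}^{\{1\},\{1\}},P_0^{\{1\},\{1\}},P_1^{\{1\},\{1\}}$ (to levels $x-1,x,x+1$). (This is a quasi-birth-and-death process.) Induced chain and drift. With $D=\{1\}$, the induced Markov chain $\mathcal L^D$ is the finite Markov chain on $S^{\{1\}}$ with transition matrix $P^D=P_{-1}^{\{1\},\{1\}}+P_0^{\{1\},\{1\}}+P_1^{\{1\},\{1\}}$. With $\pi^D$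 its stationary probability (row) vector and $\mathbf 1$ the column vector of ones, the mean drift is $a^D=\pi^D\big(-P_{-1}^{\{1\},\{1\}}+P_1^{\{1\},\{1\}}\big)\mathbf 1$. Semi-irreducibility and stability (for any countable-state Markov chain). The chain is semi-irreducible if it has exactly one irreducible (closed communicating) class $\mathcal S_0$ and every state of $\mathcal S_0$ is accessible from every state. A semi-irreducible chain is stable if $\mathcal S_0$ is positive recurrent and from every state outside $\mathcal S_0$ the first passage time to $\mathcal S_0$ is a.s. finite with finite expectation. It is unstable if either $\mathcal S_0$ is transient, or there is a state outside $\mathcal S_0$ from which, with positive probability, $\mathcal S_0$ is never reached. *)

(* Defs.v *)
From HB Require Import structures.
From mathcomp Require Import all_boot all_order all_algebra.
From mathcomp Require Import all_classical all_reals all_analysis.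

Set Implicit Arguments.
Unset Strict Implicit.
Unset Printing Implicit Defensive.

Import Order.TTheory GRing.Theory Num.Theory.

Local Open Scope classical_set_scope.
Local Open Scope ring_scope.

Section TransitionMatrix.
Variables (R : realType) (S : countType) (P : S -> S -> R).

(* The (i, j) entry of the n-th power of P; the sum over S may be infinite. *)
Fixpoint nstep (n : nat) (i j : S) : \bar R :=
  if n is m.+1 then (\esum_(k in [set: S]) ((P i k)%:E * nstep m k j))%E
  else ((i == j)%:R)%:E.

Definition accessible (i j : S) : Prop := exists n, (0 < nstep n i j)%E.

Definition irreducible_class (C : set S) : Prop :=
  [/\ C !=set0,
      forall i j, C i -> C j -> accessible i j &
      forall i j, C i -> accessible i j -> C j].

Definition semi_irreducible_with (C : set S) : Prop :=
  [/\ irreducible_class C,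
      forall C', irreducible_class C' -> C' = C &
      forall i j, C j -> accessible i j].

Definition semi_irreducible : Prop := exists C, semi_irreducible_with C.

End TransitionMatrix.

Section MarkovChain.
Variables (R : realType) (S : countType).
Variables (d : measure_display) (T : measurableType d).
(* Pr s is the law under which the chain starts in state s. *)
Variables (Pr : S -> probability T R) (Z : nat -> T -> S).

(* The Markov property is multiplied out, so that no conditioning event has to
   be assumed of positive probability; h is a trajectory of states. *)
Definition markov_chain (P : S -> S -> R) : Prop :=
  [/\ forall n s, measurable [set w | Z n w = s],
      forall s, Pr s [set w | Z 0%N w = s] = 1%E &
      forall s n (h : nat -> S),
        Pr s [set w | forall k, (k <= n.+1)%N -> Z k w = h k] =
        (Pr s [set w | forall k, (k <= n)%N -> Z k w = h k]
         * (P (h n) (h n.+1))%:E)%E].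

(* The infimum is +oo when A is not visited at any time n >= 1. Time 0 being
   excluded, this is the return time when the chain starts in A. *)
Definition passage_time (A : set S) (w : T) : \bar R :=
  ereal_inf [set (n%:R)%:E | n in [set n : nat | (0 < n)%N /\ A (Z n w)]].

Definition a_s_reached_from (s : S) (A : set S) : Prop :=
  Pr s [set w | (passage_time A w < +oo)%E] = 1%E.

Definition finite_mean_passage_from (s : S) (A : set S) : Prop :=
  (\int[Pr s]_w passage_time A w < +oo)%E.

Definition positive_recurrent (C : set S) : Prop :=
  forall s, C s ->
    a_s_reached_from s [set s] /\ finite_mean_passage_from s [set s].

Definition transient (C : set S) : Prop :=
  forall s, C s -> (Pr s [set w | passage_time [set s] w < +oo] < 1)%E.

Definition stable (C : set S) : Prop :=
  positive_recurrent C /\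
  forall s, ~ C s -> a_s_reached_from s C /\ finite_mean_passage_from s C.

Definition unstable (C : set S) : Prop :=
  transient C \/
  exists2 s, ~ C s & (0 < Pr s [set w | passage_time C w = +oo])%E.

End MarkovChain.

(* Se stands for S^emptyset and S1 for S^{1}. In the field names, the suffix
   gives the source and target boundary faces (e for emptyset, 1 for {1}), and
   Pm, P0, P1 are the blocks for level increments -1, 0, 1. *)
Record mmrrw (R : realType) (Se S1 : finType) := MMRRW {
  P0_ee : Se -> Se -> R;
  P1_e1 : Se -> S1 -> R;
  Pm_1e : S1 -> Se -> R;
  Pm_11 : S1 -> S1 -> R;
  P0_11 : S1 -> S1 -> R;
  P1_11 : S1 -> S1 -> R;
  P0_ee_ge0 : forall i j, 0 <= P0_ee i j;
  P1_e1_ge0 : forall i j, 0 <= P1_e1 i j;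
  Pm_1e_ge0 : forall i j, 0 <= Pm_1e i j;
  Pm_11_ge0 : forall i j, 0 <= Pm_11 i j;
  P0_11_ge0 : forall i j, 0 <= P0_11 i j;
  P1_11_ge0 : forall i j, 0 <= P1_11 i j;
  row_sum_level0 : forall i, \sum_j P0_ee i j + \sum_j P1_e1 i j = 1;
  row_sum_level1 : forall i,
    \sum_j Pm_1e i j + \sum_j P0_11 i j + \sum_j P1_11 i j = 1;
  row_sum_level2 : forall i,
    \sum_j Pm_11 i j + \sum_j P0_11 i j + \sum_j P1_11 i j = 1 }.

(* inl i is the state (0, i); inr (x, j) is the state (x + 1, j): the levels in
   the right summand are shifted by one. *)
Definition mmrrw_state (Se S1 : finType) : countType := (Se + nat * S1)%type.

Definition mmrrw_trans (R : realType) (Se S1 : finType) (L : mmrrw R Se S1)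
    (s t : mmrrw_state Se S1) : R :=
  match s, t with
  | inl i, inl j => P0_ee L i j
  | inl i, inr (y, j) => if y == 0%N then P1_e1 L i j else 0
  | inr (x, i), inl j => if x == 0%N then Pm_1e L i j else 0
  | inr (x, i), inr (y, j) =>
      if x == y.+1 then Pm_11 L i j
      else if y == x then P0_11 L i j
      else if y == x.+1 then P1_11 L i j
      else 0
  end.

Definition induced_trans (R : realType) (Se S1 : finType) (L : mmrrw R Se S1)
    (i j : S1) : R :=
  Pm_11 L i j + P0_11 L i j + P1_11 L i j.

Definition stationary (R : realType) (S : finType) (P : S -> S -> R)
    (p : S -> R) : Prop :=
  [/\ forall i, 0 <= p i, \sum_i p i = 1 &
      forall j, \sum_i p i * P i j = p j].

Definition mean_drift (R : realType) (Se S1 : finType) (L : mmrrw R Se S1)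
    (p : S1 -> R) : R :=
  \sum_i \sum_j p i * (- Pm_11 L i j + P1_11 L i j).

(* Main.v *)
Require Import Defs.
From HB Require Import structures.
From mathcomp Require Import all_boot all_order all_algebra.
From mathcomp Require Import all_classical all_reals all_analysis.
From mathcomp Require Import measurable_realfun ring lra.

Set Implicit Arguments.
Unset Strict Implicit.
Unset Printing Implicit Defensive.

Import Order.TTheory GRing.Theory Num.Theory.

Local Open Scope classical_set_scope.
Local Open Scope ring_scope.

(* The Poisson equation (I - P^D) w = r - a^D 1, where r is the vector of local
   drifts, is solvable because the left kernel of I - P^D is spanned by pi^D.
   Hence the function (x, j) |-> x + w_j changes by exactly a^D in mean at each
   step from the levels x >= 2.  If a^D < 0 it is a Foster-Lyapunov function,
   and expected passage times are finite.  If a^D > 0 its reciprocal is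
   superharmonic at high levels, so that from high states the low ones are
   avoided forever with positive probability: either S_0 contains arbitrarily
   high states and is transient, or it lies below some level and may be missed
   from a high state outside it.  Rows of the transition matrix have finite
   support, so the probability of avoiding a set for n steps is given by a
   recursion on finite sums. *)

(** * Transition operators with finitely supported rows, and avoidance probabilities *)

Section FiniteStep.
Variables (R : realType) (S : countType) (P : S -> S -> R) (N : S -> seq S).

Definition step (u : S -> R) (s : S) : R := \sum_(t <- N s) P s t * u t.

Record finite_step : Prop := FiniteStep {
  fs_ge0 : forall s t, 0 <= P s t;
  fs_uniq : forall s, uniq (N s);
  fs_support : forall s t, t \notin N s -> P s t = 0;
  fs_sum1 : forall s, \sum_(t <- N s) P s t = 1 }.

Hypothesis PN : finite_step.

Lemma step_cst c s : step (fun=> c) s = c.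
Proof. by rewrite /step -mulr_suml fs_sum1 // mul1r. Qed.

Lemma stepD u v s : step (fun t => u t + v t) s = step u s + step v s.
Proof. by rewrite /step -big_split /=; apply: eq_bigr => t _; rewrite mulrDr. Qed.

Lemma stepZ c u s : step (fun t => c * u t) s = c * step u s.
Proof. by rewrite /step mulr_sumr; apply: eq_bigr => t _; rewrite mulrCA. Qed.

Lemma step_sum (u : nat -> S -> R) m s :
  step (fun t => \sum_(k < m) u k t) s = \sum_(k < m) step (u k) s.
Proof.
rewrite /step exchange_big /=; apply: eq_bigr => t _.
by rewrite mulr_sumr.
Qed.

Lemma le_step u v s : (forall t, u t <= v t) -> step u s <= step v s.
Proof.
by move=> uv; apply: ler_sum => t _; rewrite ler_wpM2l // fs_ge0.
Qed.

Lemma step_ge0 u s : (forall t, 0 <= u t) -> 0 <= step u s.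
Proof. by move=> u0; rewrite -[leLHS](step_cst 0 s); exact: le_step. Qed.

Lemma le_step_term u s t : (forall t, 0 <= u t) -> P s t * u t <= step u s.
Proof.
move=> u0; have [tN|/(fs_support PN) ->] := boolP (t \in N s); last first.
  by rewrite mul0r step_ge0.
rewrite /step (big_rem t) //= lerDl sumr_ge0 // => k _.
by rewrite mulr_ge0 // fs_ge0.
Qed.

Lemma exists_successor s : exists t, 0 < P s t.
Proof.
apply/not_existsP => P0; have := fs_sum1 PN s.
rewrite big1 => [/eqP|t _]; first by rewrite eq_sym oner_eq0.
by apply/eqP; rewrite eq_le (fs_ge0 PN) andbT leNgt; apply/negP/P0.
Qed.

Lemma nstep_ge0 n s t : (0 <= nstep P n s t)%E.
Proof.
elim: n s => [|n IH] s /=; first by rewrite lee_fin ler0n.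
by apply: esum_ge0 => k _; rewrite mule_ge0 // lee_fin fs_ge0.
Qed.

(** Replaces the infinite sums in [nstep] by induction backwards along one-step transitions: a sum
    all of whose terms vanish cannot be positive. *)
Lemma accessible_ind (t : S) (Q : S -> Prop) :
  Q t -> (forall s k, 0 < P s k -> Q k -> Q s) ->
  forall s, accessible P s t -> Q s.
Proof.
move=> Qt Qstep s [n]; elim: n s => [|n IH] s /=.
  by case: eqVneq => [->|_] //; rewrite lte_fin ltxx.
move=> sum0; apply: contrapT => nQs; move: sum0; rewrite esum1 ?ltxx // => k _.
have [P0|] := ltP 0 (P s k); last first.
  by move=> P0; rewrite (_ : P s k = 0) ?mul0e //; apply/eqP; rewrite eq_le P0 fs_ge0.
apply/eqP; rewrite mule_eq0; apply/orP; right.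
rewrite eq_le nstep_ge0 andbT leNgt; apply/negP => /IH Qk.
by apply: nQs; exact: Qstep P0 Qk.
Qed.

Section Avoid.
Variable A : set S.

(* The probability, starting from s, that none of Z_1, ..., Z_n is in A. *)
Fixpoint avoid (n : nat) (s : S) : R :=
  if n is m.+1 then step (fun t => (t \notin A)%:R * avoid m t) s else 1.

Lemma avoid_ge0 n s : 0 <= avoid n s.
Proof. by elim: n s => //= n IH s; apply: step_ge0 => t; rewrite mulr_ge0. Qed.

Lemma avoid_nonincr n s : avoid n.+1 s <= avoid n s.
Proof.
elim: n s => [|n IH] s; last first.
  apply: (@le_step (fun t => _ * avoid n.+1 t) (fun t => _ * avoid n t)) => t.
  by rewrite ler_wpM2l.
rewrite -[leRHS](step_cst 1 s); apply: le_step => t /=.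
by rewrite mulr1 lern1 leq_b1.
Qed.

Lemma le_avoid m n s : (m <= n)%N -> avoid n s <= avoid m s.
Proof.
move=> /subnKC <-; elim: (n - m)%N => [|k IH]; first by rewrite addn0.
by rewrite addnS (le_trans (avoid_nonincr _ _)).
Qed.

Lemma avoid_le1 n s : avoid n s <= 1.
Proof. exact: (le_avoid s (leq0n n)). Qed.

Lemma taboo_le1 n t : (t \notin A)%:R * avoid n t <= 1.
Proof. by case: (t \notin A); rewrite ?mul1r ?avoid_le1 // mul0r. Qed.

(** Passing to complements makes all terms nonnegative, so a single successor with a positive chance
    of hitting [A] suffices. *)
Lemma avoid_lt1_step n s k : 0 < P s k ->
  (k \notin A)%:R * avoid n k < 1 -> avoid n.+1 s < 1.
Proof.
move=> Psk lt1.
have -> : avoid n.+1 s = 1 - step (fun t => 1 - (t \notin A)%:R * avoid n t) s.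
  rewrite stepD step_cst /= opprD addrA subrr add0r.
  under [in RHS]eq_fun do rewrite -mulN1r.
  by rewrite stepZ mulN1r opprK.
rewrite ltrBlDr ltrDl; apply: lt_le_trans (le_step_term s k _); last first.
  by move=> t; rewrite subr_ge0 taboo_le1.
by rewrite mulr_gt0 // subr_gt0.
Qed.

Lemma avoid_lt1 t : A t -> (forall s, accessible P s t) ->
  forall s, exists n, avoid n s < 1.
Proof.
move=> At acc s; have [k Psk] := exists_successor s.
have [n nk] : exists n, (k \notin A)%:R * avoid n k < 1.
  (* The indicator lets the induction start at [t] itself, where it is 0; [avoid] alone ignores the
     state at time 0. *)
  pose hits i := exists n, (i \notin A)%:R * avoid n i < 1.
  apply: (@accessible_ind t hits _ _ _ (acc k)) => [|i j Pij [n nj]].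
    by exists 0%N; rewrite mem_set //= mul0r.
  exists n.+1; apply: le_lt_trans (avoid_lt1_step Pij nj).
  by case: (i \notin A); rewrite ?mul1r // mul0r avoid_ge0.
by exists n.+1; exact: avoid_lt1_step nk.
Qed.

(** Since [avoid] is nonincreasing in time, the largest horizon and the smallest gap serve the whole
    finite set. *)
Lemma avoid_uniform (F : seq S) : (forall s, exists n, avoid n s < 1) ->
  exists n, exists2 e : R, 0 < e & forall s, s \in F -> avoid n s <= 1 - e.
Proof.
move=> lt1; elim: F => [|s F [n [e e0 nF]]]; first by exists 0%N, 1.
have [m ms] := lt1 s.
exists (maxn m n), (Num.min e (1 - avoid m s)).
  by rewrite lt_min e0 subr_gt0.
move=> t; rewrite inE => /predU1P[->|/nF tF].
  rewrite (le_trans (le_avoid _ (leq_maxl _ _))) // lerBrDr -lerBrDl.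
  by rewrite ge_min lexx orbT.
rewrite (le_trans (le_avoid _ (leq_maxr _ _))) // (le_trans tF) // lerD2l lerN2.
by rewrite ge_min lexx.
Qed.

(** The partial sums obey the recursion of which [V] is a supersolution, so induction on [n] keeps
    them below [V]. *)
Lemma sum_avoid_le (V : S -> R) :
  (forall s, 0 <= V s) ->
  (forall s, step (fun t => (t \notin A)%:R * V t) s <= V s - 1) ->
  forall n s, \sum_(k < n) avoid k s <= V s.
Proof.
move=> V0 QV; elim=> [|n IH] s; first by rewrite big_ord0.
have -> : \sum_(k < n.+1) avoid k s =
    1 + step (fun t => \sum_(k < n) (t \notin A)%:R * avoid k t) s.
  by rewrite (step_sum (fun k t => (t \notin A)%:R * avoid k t)) big_ord_recl.
rewrite -lerBrDl; apply: le_trans (QV s).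
by apply: le_step => t; rewrite -mulr_sumr ler_wpM2l.
Qed.

(* The function [w = avoid 0 + ... + avoid (m - 1)] decreases by [1 - avoid m]
   under the kernel killed in A; for m large this is at least some e > 0 on the
   finite set F, so a large multiple of w compensates the increase of f there. *)
Lemma foster (f : S -> R) (F : seq S) (t0 : S) :
  A t0 -> (forall s, accessible P s t0) ->
  (forall s, 0 <= f s) -> (forall s, s \notin F -> step f s <= f s - 1) ->
  exists V : S -> R, forall n s, \sum_(k < n) avoid k s <= V s.
Proof.
move=> At0 acc f0 drift.
have [m [e e0 me]] := avoid_uniform F (avoid_lt1 At0 acc).
pose b := \sum_(s <- F) `|step f s - f s + 1|.
have b0 : 0 <= b by rewrite sumr_ge0.
have fb s : step f s <= f s - 1 + (s \in F)%:R * b.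
  have [sF|/drift] := boolP (s \in F); last by rewrite mul0r addr0.
  rewrite mul1r -lerBlDl; apply: le_trans (ler_norm _) _.
  rewrite opprD opprK addrA /b (big_rem s) //= lerDl.
  by rewrite sumr_ge0.
pose w s := \sum_(k < m) avoid k s.
have w0 s : 0 <= w s by rewrite sumr_ge0 // => k _; exact: avoid_ge0.
have Qw s : step (fun t => (t \notin A)%:R * w t) s <= w s - (s \in F)%:R * e.
  under [in leLHS]eq_fun do rewrite mulr_sumr.
  rewrite (step_sum (fun k t => (t \notin A)%:R * avoid k t)).
  change (\sum_(k < m) avoid k.+1 s <= w s - (s \in F)%:R * e).
  have -> : \sum_(k < m) avoid k.+1 s = w s - 1 + avoid m s.
    have : 1 + \sum_(k < m) avoid k.+1 s = w s + avoid m s.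
      by rewrite -(big_ord_recl m (fun k => avoid k s)) big_ord_recr.
    by lra.
  have := @me s; have := avoid_le1 m s.
  by case: (s \in F) => [_ /(_ isT)|+ _]; rewrite ?mul1r ?mul0r; lra.
exists (fun s => f s + (b / e) * w s).
apply: (@sum_avoid_le (fun s => f s + (b / e) * w s)).
  by move=> s; rewrite addr_ge0 // mulr_ge0 // divr_ge0 // ltW.
move=> s; under [in leLHS]eq_fun do rewrite mulrDr mulrCA.
rewrite stepD stepZ.
have h1 : step (fun t => (t \notin A)%:R * f t) s <= step f s.
  by apply: le_step => t; case: (t \notin A); rewrite ?mul1r // mul0r.
have h2 : b / e * step (fun t => (t \notin A)%:R * w t) s <=
          b / e * w s - (s \in F)%:R * b.
  have be0 : 0 <= b / e by rewrite divr_ge0 // ltW.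
  have := ler_wpM2l be0 (Qw s).
  by rewrite mulrBr [in leRHS](mulrCA _ _ e) divfK ?gt_eqF.
by have := fb s; lra.
Qed.

(** As [u] vanishes on [A], killing in [A] does not lower its mean; hence the comparison passes
    through the recursion. *)
Lemma le_avoid_subharmonic (u : S -> R) :
  (forall s, u s <= 1) -> (forall s, A s -> u s = 0) ->
  (forall s, u s <= step u s) -> forall n s, u s <= avoid n s.
Proof.
move=> u1 uA sub; elim=> [|n IH] s //=.
apply: le_trans (sub s) (le_step _ _) => t.
case: (boolP (t \in A)) => [/set_mem/uA ->|_]; first by rewrite mul0r.
by rewrite mul1r.
Qed.

End Avoid.

(* If the escape probability is positive at t but vanishes at s, it vanishes
   at all successors of s, hence along every path from s. *)
Lemma escape_accessible (s t : S) (e : R) : accessible P s t -> 0 < e ->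
  (forall n, e <= avoid [set s] n t) ->
  exists2 e' : R, 0 < e' & forall n, e' <= avoid [set s] n s.
Proof.
pose esc (s' : S) := exists2 e' : R, 0 < e' & forall n, e' <= avoid [set s] n s'.
move=> acc e0 et; suff [] : esc s \/ esc s by [].
apply: (@accessible_ind t (fun i => esc i \/ esc s) _ _ _ acc).
  by left; exists e.
move=> i k Pik [[e' e'0 ke]|]; last by right.
(* If the path passes through [s], the bound at [k] is already one at [s]; this is why the induction
   carries a disjunction. *)
have [ks|ks] := eqVneq k s; first by right; exists e' => // n; have := ke n; rewrite ks.
left; exists (Num.min 1 (P i k * e')); first by rewrite lt_min ltr01 (mulr_gt0 Pik e'0).
case=> [|n]; first by rewrite ge_min lexx.
rewrite ge_min; apply/orP; right => /=.
apply: le_trans (le_step_term i k _); last first.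
  by move=> t'; rewrite mulr_ge0 // avoid_ge0.
rewrite ler_wpM2l ?(ltW Pik) // (_ : (k \notin _) = true) ?mul1r //.
by apply/negP => /set_mem /=; exact/eqP.
Qed.

End FiniteStep.

(** * Laws of passage times expressed through the avoidance recursion *)

Lemma probability_setI_fibers (R : realType) (d : measure_display)
    (T : measurableType d) (mu : probability T R) (S : choiceType)
    (X : T -> S) (E : set T) (r : seq S) :
  uniq r -> measurable E -> (forall s, measurable [set w | X w = s]) ->
  mu (E `&` [set w | X w \in r]) = (\sum_(s <- r) mu (E `&` [set w | X w = s]))%E.
Proof.
move=> + mE mX; elim: r => [_|s r IH /= /andP[sr ur]].
  rewrite big_nil [X in mu X](_ : _ = set0) ?measure0 //.
  by apply/seteqP; split => // w [].
have mr : measurable [set w | X w \in r].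
  rewrite (_ : mkset _ = \big[setU/set0]_(t <- r) [set w | X w = t]).
    by apply: bigsetU_measurable.
  rewrite -bigcup_seq; apply/seteqP; split => w /=; first by exists (X w).
  by case=> t /= tr ->.
rewrite big_cons -IH // -measureU; [|exact: measurableI..|].
  congr (mu _); rewrite -setIUr; congr (_ `&` _); apply/seteqP; split => w /=.
    by rewrite inE => /predU1P.
  by rewrite inE => /predU1P.
apply/seteqP; split => // w [[_ /= Xs] [_ /=]].
by rewrite Xs (negbTE sr).
Qed.

Lemma probabilityDI (R : realType) (d : measure_display) (T : measurableType d)
    (mu : probability T R) (A B : set T) : measurable A -> measurable B ->
  mu A = (mu (A `\` B) + mu (A `&` B))%E.
Proof. exact: measureDI. Qed.

Lemma probability_finE (R : realType) (d : measure_display)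
    (T : measurableType d) (mu : probability T R) (A : set T) :
  measurable A -> exists2 r : R, 0 <= r & mu A = r%:E.
Proof.
move=> mA; exists (fine (mu A)); first by rewrite fine_ge0.
by rewrite fineK // fin_num_measure.
Qed.

Section Chain.
Variables (R : realType) (S : countType) (d : measure_display).
Variables (T : measurableType d) (Pr : S -> probability T R) (Z : nat -> T -> S).
Variables (P : S -> S -> R) (N : S -> seq S).
Hypotheses (chainZ : markov_chain Pr Z P) (PN : finite_step P N).

Local Notation cylinder n h := [set w | forall k, (k <= n)%N -> Z k w = h k].

Lemma measurable_visit n (A : set S) : measurable [set w | A (Z n w)].
Proof.
case: chainZ => mZ _ _.
rewrite (_ : mkset _ = \bigcup_s (if s \in A then [set w | Z n w = s] else set0)).
  apply: countable_bigcupT_measurable; first exact: countableP.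
  by move=> s; case: ifP.
apply/seteqP; split => w /=; first by move=> Aw; exists (Z n w); rewrite ?mem_set.
by case=> s _; case: ifPn => // /set_mem As /= ->.
Qed.

(** The time [m] is excluded: this matches [passage_time] when [m = 0] and continues a cylinder that
    fixes the times up to [m]. *)
Definition survival (A : set S) (m n : nat) : set T :=
  [set w | forall k, (m < k <= n)%N -> ~ A (Z k w)].

Lemma measurable_survival A m n : measurable (survival A m n).
Proof.
rewrite (_ : survival A m n =
  \bigcap_(k in [set k | (m < k <= n)%N]) [set w | (~` A) (Z k w)]) //.
by apply: bigcap_measurableType => k _; exact: measurable_visit.
Qed.

Lemma measurable_cylinder n h : measurable (cylinder n h).
Proof.
rewrite (_ : mkset _ =
  \bigcap_(k in [set k | (k <= n)%N]) [set w | [set h k] (Z k w)]) //.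
by apply: bigcap_measurableType => k _; exact: measurable_visit.
Qed.

Definition extend (h : nat -> S) n s k := if (k <= n)%N then h k else s.

Lemma cylinder_extend n h s :
  cylinder n h `&` [set w | Z n.+1 w = s] = cylinder n.+1 (extend h n s).
Proof.
apply/seteqP; split => w /=; rewrite /extend.
  move=> [hw Zs] k; rewrite leq_eqVlt ltnS => /predU1P[->|kn].
    by rewrite ltnn.
  by rewrite kn hw.
move=> hw; split; last by rewrite hw // ltnn.
by move=> k kn; rewrite hw ?kn // ltnW.
Qed.

Lemma prob_cylinder_extend s n h t :
  Pr s (cylinder n.+1 (extend h n t)) = (Pr s (cylinder n h) * (P (h n) t)%:E)%E.
Proof.
case: chainZ => _ _ ->; rewrite /extend leqnn ltnn; congr (Pr s _ * _)%E.
by apply/seteqP; split => w /= hw k kn; have := hw k kn; rewrite kn.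
Qed.

(* The successors in [N (h n)] carry all the mass of the cylinder, so any event
   inside it can be split along the finitely many values of Z_(n+1). *)
Lemma prob_split_successor s n h (E : set T) :
  measurable E -> E `<=` cylinder n h ->
  Pr s E = (\sum_(t <- N (h n)) Pr s (E `&` [set w | Z n.+1 w = t]))%E.
Proof.
move=> mE Esub; have mN : measurable [set w | Z n.+1 w \in N (h n)].
  exact: (measurable_visit n.+1 [set t | t \in N (h n)]).
have mZ t : measurable [set w | Z n.+1 w = t].
  exact: (measurable_visit n.+1 [set t]).
have mC := measurable_cylinder n h.
rewrite -probability_setI_fibers ?(fs_uniq PN) // (probabilityDI (Pr s) mE mN).
rewrite (_ : Pr s (E `\` _) = 0%E) ?add0e //.
apply/eqP; rewrite -measure_le0.
apply: (@le_trans _ _ (Pr s (cylinder n h `\` [set w | Z n.+1 w \in N (h n)]))).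
  by apply: le_measure; rewrite ?inE; [exact: measurableD..|exact: setSD].
have Pfin := fin_num_measure (Pr s) _ mC.
have full : Pr s (cylinder n h `&` [set w | Z n.+1 w \in N (h n)]) =
            Pr s (cylinder n h).
  rewrite probability_setI_fibers ?(fs_uniq PN) //.
  under eq_bigr do rewrite cylinder_extend prob_cylinder_extend.
  rewrite -(fineK Pfin); under eq_bigr do rewrite -EFinM.
  by rewrite sumEFin -mulr_sumr (fs_sum1 PN) mulr1.
have := probabilityDI (Pr s) mC mN; rewrite full.
move=> /esym; set a := Pr s (_ `\` _) => /eqP.
rewrite -(fineK Pfin).
case: a => [a| |] //=; rewrite eqe => /eqP e; rewrite lee_fin.
by move: e => /(congr1 (fun z => z - fine (Pr s (cylinder n h)))); lra.
Qed.

(** Induction on [m] for all cylinders at once: splitting along the next state lengthens the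
    cylinder by one and reproduces the recursion of [avoid]. *)
Lemma prob_cylinder_survival A m n h s :
  Pr s (cylinder n h `&` survival A n (n + m)) =
  (Pr s (cylinder n h) * (avoid P N A m (h n))%:E)%E.
Proof.
elim: m n h => [|m IH] n h.
  rewrite addn0 mule1; congr (Pr s _); apply/seteqP; split => w; first by case.
  by move=> hw; split => // k /andP[nk /(leq_trans nk)]; rewrite ltnn.
rewrite (@prob_split_successor s n h); last 2 first.
- by apply: measurableI; [exact: measurable_cylinder|exact: measurable_survival].
- by move=> w [].
have Pfin := fin_num_measure (Pr s) _ (measurable_cylinder n h).
transitivity (\sum_(t <- N (h n)) (Pr s (cylinder n h) *
  (P (h n) t * ((t \notin A)%:R * avoid P N A m t))%:E))%E; last first.
  rewrite -(fineK Pfin); under eq_bigr do rewrite -EFinM.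
  by rewrite sumEFin -mulr_sumr.
apply: eq_bigr => t _; case: (boolP (t \in A)) => [/set_mem At|/negP tA].
  rewrite mul0r mulr0 mule0 [X in Pr s X](_ : _ = set0) ?measure0 //.
  apply/seteqP; split => // w /= [[_ sw] Zt].
  by apply: (sw n.+1); rewrite ?Zt // ltnS leqnn addnS ltnS leq_addr.
rewrite mul1r EFinM muleA -prob_cylinder_extend.
rewrite (_ : avoid _ _ _ m t = avoid P N A m (extend h n t n.+1)); last first.
  by rewrite /extend ltnn.
rewrite -IH; congr (Pr s _); rewrite -cylinder_extend addSnnS.
apply/seteqP; split => w /=.
  move=> [[hw sw] Zt]; do 2?split => //.
  by move=> k /andP[nk km]; apply: sw; rewrite (ltnW nk).
move=> [[hw Zt] sw]; do 2?split => //.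
move=> k /andP[]; rewrite leq_eqVlt => /predU1P[<- _|nk km].
  by rewrite Zt => At; apply: tA; rewrite mem_set.
by apply: sw; rewrite nk.
Qed.

Lemma prob_survival A n s : Pr s (survival A 0 n) = (avoid P N A n s)%:E.
Proof.
have mC := measurable_cylinder 0 (fun=> s); have mS := measurable_survival A 0 n.
have C1 : Pr s (cylinder 0%N (fun=> s)) = 1%E.
  case: chainZ => _ Z0 _; rewrite -(Z0 s); congr (Pr s _).
  by apply/seteqP; split => w /= => [->|Zs k]; rewrite ?leqn0 // => /eqP ->.
have := prob_cylinder_survival A n 0 (fun=> s) s.
rewrite add0n C1 mul1e => <-.
rewrite (probabilityDI (Pr s) mS mC) setIC (_ : Pr s (_ `\` _) = 0%E) ?add0e //.
apply/eqP; rewrite -measure_le0.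
apply: (@le_trans _ _ (Pr s (~` (cylinder 0%N (fun=> s))))).
  by apply: le_measure; rewrite ?inE; [exact: measurableD|exact: measurableC|move=> w []].
by rewrite probability_setC // C1 subee.
Qed.

(** A time with values in the naturals or infinity is the sum over [n] of the indicators that it
    exceeds [n]. *)
Lemma passage_timeE A w :
  passage_time R Z A w = (\sum_(n <oo) (\1_(survival A 0 n) w)%:E)%E.
Proof.
have [ex|nA] := pselect (exists n, (0 < n)%N && (Z n w \in A)).
  have [m /andP[m0 /set_mem Am] mmin] := ex_minnP ex.
  (* With [m] the first positive visit time, exactly the indicators of index below [m] equal 1. *)
  have sm n : (n < m)%N -> w \in survival A 0 n.
    move=> nm; rewrite mem_set // => k /andP[k0 kn] Ak.
    have := mmin k; rewrite k0 mem_set // => /(_ isT).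
    by rewrite leqNgt (leq_ltn_trans kn nm).
  have nsm n : (m <= n)%N -> w \in survival A 0 n = false.
    move=> mn; apply/negP => /set_mem/(_ m); rewrite m0 mn => /(_ isT).
    exact.
  rewrite (nneseries_split 0 m) => [|k _]; last by rewrite lee_fin.
  rewrite [X in (_ + X)%E]eseries0 => [|k mk _]; last first.
    by rewrite indicE nsm.
  rewrite adde0 add0n big_mkord.
  under eq_bigr => k _ do rewrite indicE (sm k (ltn_ord k)).
  rewrite sumEFin sumr_const card_ord; apply/eqP; rewrite eq_le.
  apply/andP; split; first by apply: ereal_inf_lbound; exists m.
  apply/ereal_infP => _ [k /= [k0 Ak] <-]; rewrite lee_fin ler_nat.
  by apply: mmin; rewrite k0 mem_set.
have sn n : w \in survival A 0 n.
  rewrite mem_set // => k /andP[k0 _] Ak; apply: nA; exists k.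
  by rewrite k0 mem_set.
rewrite /passage_time [X in ereal_inf X](_ : _ = set0) ?ereal_inf0; last first.
  apply/seteqP; split => // _ [k /= [k0 Ak] _]; apply: nA; exists k.
  by rewrite k0 mem_set.
apply/esym/eq_infty => r.
apply: le_trans (nneseries_lim_ge (Num.bound `|r|) _); last first.
  by move=> k _ _; rewrite lee_fin.
rewrite big_mkord; under eq_bigr => k _ do rewrite indicE sn.
by rewrite sumEFin sumr_const card_ord lee_fin (le_trans (ler_norm r)) // ltW // archi_boundP.
Qed.

Lemma expected_passage_time A s :
  (\int[Pr s]_w passage_time R Z A w = \sum_(n <oo) (avoid P N A n s)%:E)%E.
Proof.
under eq_integral do rewrite passage_timeE.
rewrite integral_nneseries //; last first.
  move=> n; apply/measurable_EFinP; apply: measurable_indic.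
  exact: measurable_survival.
apply: eq_eseriesr => n _; rewrite integral_indic ?setIT //; first exact: prob_survival.
exact: measurable_survival.
Qed.

Lemma passage_time_pinfty A :
  [set w | passage_time R Z A w = +oo%E] = \bigcap_n survival A 0 n.
Proof.
apply/seteqP; split => w /=.
  move=> winf n _ k /andP[k0 _] Ak.
  have : (passage_time R Z A w <= k%:R%:E)%E.
    by apply: ereal_inf_lbound; exists k.
  by rewrite winf.
move=> sw; rewrite /passage_time [X in ereal_inf X](_ : _ = set0) ?ereal_inf0 //.
apply/seteqP; split => // _ [k /= [k0 Ak] _].
by apply: (sw k I k) => //; rewrite k0 /=.
Qed.

Lemma passage_time_ltpinfty A :
  [set w | (passage_time R Z A w < +oo)%E] = ~` \bigcap_n survival A 0 n.
Proof.
rewrite -passage_time_pinfty; apply/seteqP; split => w /=; rewrite ltey => /eqP //.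
Qed.

Lemma measurable_never A : measurable (\bigcap_n survival A 0 n).
Proof. by apply: bigcap_measurableType => n _; exact: measurable_survival. Qed.

(** Continuity from above along the decreasing events [survival A 0 n]. *)
Lemma prob_never_ge A s e : (forall n, e <= avoid P N A n s) ->
  (e%:E <= Pr s (\bigcap_n survival A 0 n))%E.
Proof.
move=> le_e.
have cv : (Pr s \o survival A 0) n @[n --> \oo] --> Pr s (\bigcap_n survival A 0 n).
  apply: nonincreasing_cvg_mu.
  - by rewrite ltey_eq fin_num_measure //; exact: measurable_survival.
  - by move=> n; exact: measurable_survival.
  - exact: measurable_never.
  - move=> m n mn; apply/subsetPset => w sw k /andP[k0 kn].
    by apply: sw; rewrite k0 (leq_trans kn).
rewrite -(cvg_lim _ cv) //; apply: lime_ge; first by apply/cvg_ex; eexists; exact: cv.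
by apply: nearW => n /=; rewrite prob_survival lee_fin.
Qed.

Lemma prob_never_le A s n :
  (Pr s (\bigcap_n survival A 0 n) <= (avoid P N A n s)%:E)%E.
Proof.
rewrite -prob_survival; apply: le_measure; rewrite ?inE.
- exact: measurable_never.
- exact: measurable_survival.
- by move=> w; apply.
Qed.

(** The sums converge to the mean passage time. Their bound also forces almost sure passage: a
    probability [r > 0] of never reaching [A] would make them grow at least like [n * r]. *)
Lemma passage_finite A s c : (forall n, \sum_(k < n) avoid P N A k s <= c) ->
  a_s_reached_from Pr Z s A /\ finite_mean_passage_from Pr Z s A.
Proof.
move=> sumc; split.
  rewrite /a_s_reached_from passage_time_ltpinfty probability_setC; last first.
    exact: measurable_never.
  have [r + Er] := probability_finE (Pr s) (measurable_never A).
  have le_av := prob_never_le A s; rewrite Er in le_av *.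
  rewrite le_eqVlt => /predU1P[<-|r0]; first by rewrite sube0.
  have c0 : 0 <= c by have := sumc 0%N; rewrite big_ord0.
  have /archi_boundP : 0 <= c / r by rewrite divr_ge0 // ltW.
  rewrite ltr_pdivrMr // ltNge => /negP[]; apply: le_trans (sumc (Num.bound (c / r))).
  rewrite mulr_natl -[X in _ *+ X]card_ord -sumr_const ler_sum // => k _.
  by rewrite -lee_fin.
rewrite /finite_mean_passage_from expected_passage_time.
apply: (@le_lt_trans _ _ c%:E); last exact: ltry.
apply: lime_le; first by apply: is_cvg_nneseries => n _ _; rewrite lee_fin avoid_ge0.
by apply: nearW => n /=; rewrite sumEFin lee_fin big_mkord.
Qed.

Lemma escape_unstable A s e : 0 < e -> (forall n, e <= avoid P N A n s) ->
  (Pr s [set w | (passage_time R Z A w < +oo)%E] < 1)%E /\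
  (0 < Pr s [set w | passage_time R Z A w = +oo%E])%E.
Proof.
move=> e0 /prob_never_ge; rewrite passage_time_pinfty passage_time_ltpinfty.
rewrite probability_setC; last exact: measurable_never.
have [r _ ->] := probability_finE (Pr s) (measurable_never A).
rewrite lee_fin => er; have r0 := lt_le_trans e0 er.
by rewrite !lte_fin r0 ltrBlDr ltrDl.
Qed.

End Chain.

(** * Linear algebra and the Poisson equation of a finite chain *)

Lemma finite_system_solvable (F : fieldType) (S : finType) (a : S -> S -> F) :
  (forall x, (forall i, \sum_j a i j * x j = 0) -> forall j, x j = 0) ->
  forall w, exists x, forall i, \sum_j a i j * x j = w i.
Proof.
move=> inj w.
(* The transpose of [a], because row vectors multiply from the left. *)
pose A := \matrix_(i < #|S|, j < #|S|) a (enum_val j) (enum_val i).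
have mulA (u : 'rV_#|S|) i :
    (u *m A) 0 (enum_rank i) = \sum_j a i j * u 0 (enum_rank j).
  rewrite mxE (reindex enum_rank) /=; last by apply: onW_bij; exact: enum_rank_bij.
  by apply: eq_bigr => j _; rewrite mxE !enum_rankK mulrC.
have Aunit : A \in unitmx.
  rewrite -row_free_unit; apply: inj_row_free => u uA0; apply/rowP => k.
  rewrite mxE -(enum_valK k).
  apply: (inj (fun j => u 0 (enum_rank j))) => i.
  by rewrite -mulA uA0 mxE.
exists (fun j => (\row_k w (enum_val k) *m invmx A) 0 (enum_rank j)) => i.
by rewrite -mulA mulmxKV // mxE enum_rankK.
Qed.

Section Poisson.
Variables (R : realType) (S : finType) (P : S -> S -> R) (p : S -> R).
Hypotheses (P_ge0 : forall i j, 0 <= P i j) (P_sum1 : forall i, \sum_j P i j = 1).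
Hypotheses (semi_irr : semi_irreducible P) (p_stat : stationary P p).

Let N (i : S) := enum S.

Let PN : finite_step (P : (S : countType) -> (S : countType) -> R) N.
Proof.
split=> //; first by move=> i; exact: enum_uniq.
  by move=> i j; rewrite mem_enum.
by move=> i; rewrite big_enum.
Qed.

(** Maximum principle: at a maximiser the nonnegative gap to the maximum has mean 0, so every
    successor is a maximiser, and so is [t] at the end of a path. *)
Lemma harmonic_le (v : S -> R) (t : S) : (forall i, accessible P i t) ->
  (forall i, \sum_j P i j * v j = v i) -> forall i, v i <= v t.
Proof.
move=> acc harm i0.
have [i _ imax] := arg_maxP v (erefl : predT i0).
have vi j : v j <= v i by exact: imax.
suff -> : v t = v i by exact: vi.
apply: (@accessible_ind R S P N PN t (fun k => v k = v i -> v t = v i) _ _ i) => //.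
move=> s k Psk vk vs; apply: vk; apply/eqP; rewrite eq_le vi //=.
have := @le_step_term R S P N PN (fun j => v i - v j) s k.
have -> : step P N (fun j => v i - v j) s = 0.
  rewrite stepD (step_cst PN) -vs -[in X in X + _]harm /step big_enum /= -big_split /=.
  by rewrite big1 // => j _; rewrite mulrN subrr.
rewrite pmulr_rle0 // subr_le0; apply => j.
by rewrite subr_ge0 vi.
Qed.

(** The maximum principle for [v] and [- v], at a state accessible from everywhere. *)
Lemma harmonic_constant (v : S -> R) :
  (forall i, \sum_j P i j * v j = v i) -> forall i j, v i = v j.
Proof.
move=> harm; case: semi_irr => C [[[t Ct] _ _] _ /(_ _ t Ct) acc].
suff vt i : v i = v t by move=> i j; rewrite !vt.
apply/eqP; rewrite eq_le harmonic_le //= -lerN2.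
apply: (harmonic_le (v := fun j => - v j)) => // j.
by under eq_bigr do rewrite mulrN; rewrite sumrN harm.
Qed.

(* [I - P + 1 p] is invertible: p annihilates the image of [I - P], so that a
   vector in its kernel is harmonic with p-mean 0. *)
Lemma poisson_equation (r : S -> R) :
  exists v, forall i, \sum_j P i j * v j = v i - r i + \sum_j p j * r j.
Proof.
case: p_stat => p0 p1 pP.
pose a i j := (i == j)%:R - P i j + p j.
have aE x i : \sum_j a i j * x j =
    x i - \sum_j P i j * x j + \sum_j p j * x j.
  under eq_bigr do rewrite mulrDl mulrBl.
  rewrite big_split sumrB /=; congr (_ - _ + _).
  rewrite (bigD1 i) //= eqxx mul1r big1 ?addr0 // => j ji.
  by rewrite eq_sym (negbTE ji) mul0r.
have pIP x : \sum_i p i * (x i - \sum_j P i j * x j) = 0.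
  under eq_bigr do rewrite mulrBr mulr_sumr.
  rewrite sumrB exchange_big /=; apply/eqP; rewrite subr_eq0; apply/eqP.
  apply: eq_bigr => j _; rewrite -pP mulr_suml.
  by apply: eq_bigr => i _; rewrite mulrA.
have pa x : \sum_i p i * (\sum_j a i j * x j) = \sum_j p j * x j.
  under eq_bigr do rewrite aE mulrDr.
  by rewrite big_split /= pIP add0r -mulr_suml p1 mul1r.
have inj x : (forall i, \sum_j a i j * x j = 0) -> forall j, x j = 0.
  move=> ax0; have px0 : \sum_j p j * x j = 0.
    by rewrite -pa big1 // => i _; rewrite ax0 mulr0.
  have xc : forall i j, x i = x j.
    apply: harmonic_constant => i; have := ax0 i.
    by rewrite aE px0 addr0 => /eqP; rewrite subr_eq0 => /eqP.
  move=> j; rewrite -[LHS]mul1r -p1 mulr_suml -[RHS]px0.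
  by apply: eq_bigr => i _; rewrite (xc j i).
pose c := \sum_j p j * r j.
have [v av] := finite_system_solvable inj (fun i => r i - c).
(* The vector [r - c] has [p]-mean 0, hence so has [v], and the rank-one term drops out of the
   system. *)
have pv : \sum_j p j * v j = 0.
  rewrite -pa; under eq_bigr do rewrite av mulrBr.
  by rewrite sumrB -mulr_suml p1 mul1r subrr.
exists v => i; have := av i; rewrite aE pv -/c; lra.
Qed.

End Poisson.

(** * The transition kernel of the MMRRW, level by level *)

Section MMRRW.
Variables (R : realType) (Se S1 : finType) (L : mmrrw R Se S1).
Local Notation state := (mmrrw_state Se S1).

Definition level0 : seq state := [seq inl i | i <- enum Se].
(* [level x] is level x + 1 of the paper, as in [mmrrw_state]. *)
Definition level (x : nat) : seq state := [seq inr (x, j) | j <- enum S1].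

Definition mmrrw_succ (s : state) : seq state :=
  match s with
  | inl _ => level0 ++ level 0
  | inr (0, _) => level0 ++ level 0 ++ level 1
  | inr (x.+1, _) => level x ++ level x.+1 ++ level x.+2
  end.

Lemma mem_level0 i : inl i \in level0.
Proof. by apply/mapP; exists i; rewrite ?mem_enum. Qed.

Lemma mem_level x y j : (inr (y, j) \in level x) = (y == x).
Proof.
apply/mapP/eqP => [[k _ [-> _]]//|->]; by exists j; rewrite ?mem_enum.
Qed.

Lemma inr_notin_level0 z : inr z \notin level0.
Proof. by apply/mapP => -[]. Qed.

Lemma uniq_level0 : uniq level0.
Proof. by rewrite map_inj_uniq ?enum_uniq // => i j []. Qed.

Lemma uniq_level x : uniq (level x).
Proof. by rewrite map_inj_uniq ?enum_uniq // => i j []. Qed.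

Lemma sum_level0 (F : state -> R) : \sum_(t <- level0) F t = \sum_i F (inl i).
Proof. by rewrite big_map big_enum. Qed.

Lemma sum_level x (F : state -> R) :
  \sum_(t <- level x) F t = \sum_j F (inr (x, j)).
Proof. by rewrite big_map big_enum. Qed.

Lemma has_level0_level x : has (mem level0) (level x) = false.
Proof.
by apply/hasP => -[_ /mapP[j _ ->]] /=; apply/negP/inr_notin_level0.
Qed.

Lemma has_level x y : x != y -> has (mem (level x)) (level y) = false.
Proof.
move=> xy; apply/hasP => -[_ /mapP[j _ ->]] /=.
by rewrite mem_level eq_sym (negbTE xy).
Qed.

(** The index [x.+1] stands for a level at least 2, from which the blocks do not depend on the
    level. *)
Lemma step_upper (u : state -> R) x i :
  step (mmrrw_trans L) mmrrw_succ u (inr (x.+1, i)) =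
    \sum_j Pm_11 L i j * u (inr (x, j)) +
    \sum_j P0_11 L i j * u (inr (x.+1, j)) +
    \sum_j P1_11 L i j * u (inr (x.+2, j)).
Proof.
rewrite /step /mmrrw_succ !big_cat /= !sum_level addrA.
congr (_ + _ + _); apply: eq_bigr => j _ /=; rewrite ?eqxx //.
  by rewrite -[x.+1 == x.+2]/(x == x.+1) ltn_eqF // eqxx.
rewrite -[x.+1 == x.+3]/(x == x.+2) ltn_eqF // -[x.+2 == x.+1]/(x.+1 == x).
by rewrite gtn_eqF ?eqxx.
Qed.

Lemma mmrrw_finite_step : finite_step (mmrrw_trans L) mmrrw_succ.
Proof.
split.
- case=> [i|[x i]] [j|[y j]] /=; rewrite ?P0_ee_ge0 //.
  + by case: ifP => // _; exact: P1_e1_ge0.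
  + by case: ifP => // _; exact: Pm_1e_ge0.
  + do 3?[case: ifP => _]; rewrite ?Pm_11_ge0 ?P0_11_ge0 ?P1_11_ge0 //.
- case=> [i|[[|x] i]] /=; rewrite !cat_uniq ?has_cat ?uniq_level0 ?uniq_level
    ?has_level0_level ?has_level ?neq_ltn ?ltnSn ?leqnSn //=.
- case=> [i|[[|x] i]] [j|[y j]] //=; rewrite !mem_cat ?mem_level0 ?mem_level //=.
  + by rewrite (negbTE (inr_notin_level0 _)) /= => /negbTE ->.
  + by rewrite (negbTE (inr_notin_level0 _)) /= => /norP[/negbTE-> /negbTE->].
  + rewrite eqSS => /norP[/negbTE yx /norP[/negbTE -> /negbTE ->]].
    by rewrite eq_sym yx.
- case=> [i|[[|x] i]].
  + by rewrite /= big_cat /= sum_level0 sum_level /= row_sum_level0.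
  + by rewrite /= !big_cat /= sum_level0 !sum_level /= addrA row_sum_level1.
  + have := step_upper (fun=> 1) x i.
    rewrite /step; under eq_bigr do rewrite mulr1.
    move=> ->; rewrite -[RHS](row_sum_level2 L i).
    by congr (_ + _ + _); apply: eq_bigr => j _; rewrite mulr1.
Qed.

Let PN := mmrrw_finite_step.

(** * The Lyapunov function and escape from low levels *)

Section Lyapunov.
Variables (w : S1 -> R) (a : R).
Hypothesis w_ge0 : forall j, 0 <= w j.
Hypothesis w_poisson : forall i, \sum_j induced_trans L i j * w j =
  w i - \sum_j (- Pm_11 L i j + P1_11 L i j) + a.

Definition lyapunov (s : state) : R :=
  if s is inr (x, j) then x%:R + w j else 0.

Lemma lyapunov_ge0 s : 0 <= lyapunov s.
Proof. by case: s => [i|[x j]] //=; rewrite addr_ge0. Qed.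

Lemma lyapunov_drift x i :
  step (mmrrw_trans L) mmrrw_succ lyapunov (inr (x.+1, i)) =
  lyapunov (inr (x.+1, i)) + a.
Proof.
rewrite step_upper /=.
have := w_poisson i; have := row_sum_level2 L i.
have -> : \sum_j induced_trans L i j * w j = \sum_j Pm_11 L i j * w j +
    \sum_j P0_11 L i j * w j + \sum_j P1_11 L i j * w j.
  by rewrite -!big_split /=; apply: eq_bigr => j _; rewrite !mulrDl.
rewrite big_split sumrN /=.
have distr (p : S1 -> R) (y : R) :
    \sum_j p j * (y + w j) = (\sum_j p j) * y + \sum_j p j * w j.
  by rewrite mulr_suml -big_split; apply: eq_bigr => j _; rewrite mulrDr.
rewrite !distr -[x.+2]addn1 -[x.+1]addn1 !natrD.
set m := \sum_j Pm_11 L i j; set z := \sum_j P0_11 L i j.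
set q := \sum_j P1_11 L i j => mzq E.
have -> : m = 1 - z - q by lra.
by move: E; rewrite (_ : m = 1 - z - q); [lra|lra].
Qed.

Let W := \sum_j w j.

Lemma w_le j : w j <= W.
Proof. by rewrite /W (bigD1 j) //= lerDl sumr_ge0. Qed.

Lemma lyapunov_jump x i t : t \in mmrrw_succ (inr (x.+1, i)) ->
  `|lyapunov t - lyapunov (inr (x.+1, i))| <= 1 + W.
Proof.
have bound (y z : nat) j : (y <= z.+1)%N -> (z <= y.+1)%N ->
    `|y%:R + w j - (z%:R + w i)| <= 1 + W.
  rewrite -!(ler_nat R) -!natr1 => yz zy.
  have := w_le i; have := w_le j; have := w_ge0 i; have := w_ge0 j.
  by rewrite ler_norml => *; apply/andP; split; lra.
by rewrite !mem_cat => /or3P[] /mapP[j _ ->] /=; apply: bound; rewrite // ltnW.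
Qed.

Hypothesis a_gt0 : 0 < a.

(* Above this value of the Lyapunov function, [1 / lyapunov] is superharmonic:
   with D the jump, 1/(f + D) <= 1/f - D/f^2 + a/f^2 as soon as
   D^2 <= a (f + D), and the right-hand side has mean 1/f. *)
Definition escape_threshold : R := 1 + W + (1 + W) ^+ 2 / a.

Lemma escape_threshold_gt : 1 + W <= escape_threshold.
Proof. by rewrite /escape_threshold lerDl divr_ge0 ?sqr_ge0 // ltW. Qed.

(** For [c >= 0] this is the positive part of [1 - c / lyapunov s], with value 0 at low states as
    [le_avoid_subharmonic] demands on [A]. *)
Definition escape_fun (c : R) (s : state) : R :=
  if c < lyapunov s then 1 - c / lyapunov s else 0.

Lemma W_ge0 : 0 <= W.
Proof. by rewrite sumr_ge0. Qed.

Lemma inv_jump_le (f g : R) : 0 < f -> 0 < g -> (g - f) ^+ 2 <= a * g ->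
  g^-1 <= f^-1 + (f^-1 ^+ 2 * a - f^-1 ^+ 2 * (g - f)).
Proof.
move=> f0 g0 h; rewrite -subr_ge0.
have -> : f^-1 + (f^-1 ^+ 2 * a - f^-1 ^+ 2 * (g - f)) - g^-1 =
    f^-1 ^+ 2 * g^-1 * (a * g - (g - f) ^+ 2).
  by field; rewrite !gt_eqF.
by rewrite !mulr_ge0 ?sqr_ge0 ?invr_ge0 ?subr_ge0 // ltW.
Qed.

Lemma escape_fun_ge0 c s : 0 <= escape_fun c s.
Proof.
rewrite /escape_fun; case: ifP => // cf; have [c0|c0] := ltP 0 c.
  by rewrite subr_ge0 ler_pdivrMr ?mul1r ?ltW // (lt_trans c0).
by rewrite subr_ge0 (le_trans _ ler01) // mulr_le0_ge0 // invr_ge0 lyapunov_ge0.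
Qed.

Lemma escape_fun_le1 c s : 0 <= c -> escape_fun c s <= 1.
Proof.
move=> c0; rewrite /escape_fun; case: ifP => // cf.
by rewrite gerBl divr_ge0 // lyapunov_ge0.
Qed.

Lemma escape_fun_gt0 c s : 0 <= c -> c < lyapunov s -> 0 < escape_fun c s.
Proof.
move=> c0 cf; rewrite /escape_fun cf subr_gt0 ltr_pdivrMr ?mul1r //.
exact: le_lt_trans cf.
Qed.

Lemma escape_fun_ge c s : 0 <= c -> 0 < lyapunov s ->
  1 - c / lyapunov s <= escape_fun c s.
Proof.
move=> c0 f0; rewrite /escape_fun; case: ltP => // fc.
by rewrite subr_le0 ler_pdivlMr ?mul1r.
Qed.

Lemma escape_fun_subharmonic c s : escape_threshold <= c ->
  escape_fun c s <= step (mmrrw_trans L) mmrrw_succ (escape_fun c) s.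
Proof.
move=> thc; have W0 := W_ge0.
have Wc : 1 + W <= c := le_trans escape_threshold_gt thc.
have c0 : 0 <= c by lra.
have [|fc] := ltP c (lyapunov s); last first.
  rewrite {1}/escape_fun ltNge fc /=.
  by apply: (step_ge0 PN) => t; exact: escape_fun_ge0.
case: s => [i|[[|x] i]] cf; rewrite /= in cf.
- by move: cf; rewrite ltNge c0.
(* At level 1 the Lyapunov function is at most [W], hence below [c]. *)
- by have := w_le i; lra.
set s := inr (x.+1, i) in cf *; have {}cf : c < lyapunov s by [].
set f := lyapunov s in cf; have f0 : 0 < f by lra.
rewrite {1}/escape_fun cf.
(* An affine function of [lyapunov t] whose mean is [1 - c / f] because the drift is exactly [a]; on
   each successor it will be bounded by [escape_fun c]. *)
have -> : 1 - c / f = step (mmrrw_trans L) mmrrw_succ (fun t =>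
    1 - c * f^-1 - c * f^-1 ^+ 2 * (a + f) + c * f^-1 ^+ 2 * lyapunov t) s.
  rewrite stepD (step_cst PN) stepZ lyapunov_drift -/s -/f.
  by field; rewrite gt_eqF.
rewrite /step big_seq [leRHS]big_seq; apply: ler_sum => t ts; rewrite ler_wpM2l ?(fs_ge0 PN) //.
have := lyapunov_jump ts; rewrite -/s -/f; set g := lyapunov t => gf.
(* A jump of at most [1 + W] from above the threshold leaves this margin, so the squared jump is at
   most [a * g]. *)
have Wa : (1 + W) ^+ 2 / a <= g.
  have := thc; rewrite /escape_threshold.
  by move: gf; rewrite ler_norml => /andP[? ?]; lra.
have g0 : 0 < g.
  by apply: lt_le_trans Wa; rewrite divr_gt0 // exprn_gt0 //; lra.
apply: le_trans (escape_fun_ge c0 g0); rewrite -/g.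
have := @inv_jump_le f g f0 g0.
have -> : (g - f) ^+ 2 <= a * g.
  rewrite mulrC -ler_pdivrMr //; apply: le_trans Wa.
  rewrite ler_pM2r ?invr_gt0 // -[leLHS]real_normK ?num_real //.
  by rewrite lerXn2r ?nnegrE //; lra.
move=> /(_ isT) h.
have := ler_wpM2l c0 h; rewrite -subr_ge0 => h1; rewrite -subr_ge0.
by apply: le_trans h1 _; rewrite le_eqVlt; apply/orP; left; apply/eqP; ring.
Qed.

Lemma escape_positive c (A : set state) : escape_threshold <= c ->
  (forall s, A s -> lyapunov s <= c) ->
  forall t, c < lyapunov t ->
  exists2 e : R, 0 < e & forall n, e <= avoid (mmrrw_trans L) mmrrw_succ A n t.
Proof.
move=> thc Ac t ct; have c0 : 0 <= c.
  by have := W_ge0; have := escape_threshold_gt; lra.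
exists (escape_fun c t); first exact: escape_fun_gt0.
move=> n; apply: (le_avoid_subharmonic PN).
- by move=> s; exact: escape_fun_le1.
- by move=> s /Ac fc; rewrite /escape_fun ltNge fc.
- by move=> s; exact: escape_fun_subharmonic.
Qed.

End Lyapunov.

(** Rows of [induced_trans L] sum to 1, so a solution may be shifted by a constant large enough to
    make it nonnegative. *)
Lemma poisson_nonneg (p : S1 -> R) : semi_irreducible (induced_trans L) ->
  stationary (induced_trans L) p ->
  exists2 w : S1 -> R, forall j, 0 <= w j &
    forall i, \sum_j induced_trans L i j * w j =
      w i - \sum_j (- Pm_11 L i j + P1_11 L i j) + mean_drift L p.
Proof.
move=> semi stat.
have PD0 i j : 0 <= induced_trans L i j.
  by rewrite !addr_ge0 ?Pm_11_ge0 ?P0_11_ge0 ?P1_11_ge0.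
have PD1 i : \sum_j induced_trans L i j = 1.
  by rewrite !big_split /= row_sum_level2.
have [v vE] := poisson_equation PD0 PD1 semi stat
  (fun i => \sum_j (- Pm_11 L i j + P1_11 L i j)).
pose b := \sum_j `|v j|.
exists (fun j => v j + b) => [j|i].
  rewrite -lerBlDr sub0r lerNl (le_trans (ler_norm _)) // normrN.
  by rewrite /b (bigD1 j) //= lerDl sumr_ge0.
under eq_bigr do rewrite mulrDr.
rewrite big_split -mulr_suml PD1 mul1r /= vE.
have -> : mean_drift L p = \sum_j p j * \sum_k (- Pm_11 L j k + P1_11 L j k).
  by apply: eq_bigr => j _; rewrite mulr_sumr.
lra.
Qed.

End MMRRW.

(** * Assembly: the Foster bound for negative drift, the escape estimate for positive drift *)

Theorem theorem3p3 (R : realType) (Se S1 : finType)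
  (Se_neq0 : (0 < #|Se|)%N) (S1_neq0 : (0 < #|S1|)%N)
  (L : mmrrw R Se S1)
  (d : measure_display) (T : measurableType d)
  (Pr : mmrrw_state Se S1 -> probability T R)
  (Z : nat -> T -> mmrrw_state Se S1)
  (chainZ : markov_chain Pr Z (mmrrw_trans L))
  (S0 : set (mmrrw_state Se S1))
  (semi_irr : semi_irreducible_with (mmrrw_trans L) S0)
  (S0_level0 : exists i : Se, S0 (inl i))
  (semi_irrD : semi_irreducible (induced_trans L))
  (piD : S1 -> R) (piD_stationary : stationary (induced_trans L) piD) :
  (mean_drift L piD < 0 -> stable Pr Z S0) /\
  (0 < mean_drift L piD -> unstable Pr Z S0).
Proof.
have PN := mmrrw_finite_step L.
have [w w0 wE] := poisson_nonneg semi_irrD piD_stationary.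
have [[[s0 S0s0] S0_acc _] _ S0_from] := semi_irr.
set a := mean_drift L piD in wE *; pose f := lyapunov (Se := Se) w.
split=> [a_lt0|a_gt0].
  (* Taken with [A = [set s]] for positive recurrence and with [A = S0] for passage from outside. *)
  have finite_passage (A : set (mmrrw_state Se S1)) s t : A t -> S0 t ->
      a_s_reached_from Pr Z s A /\ finite_mean_passage_from Pr Z s A.
    move=> At S0t.
    (* Dividing by [- a] normalises the drift to -1 outside the finite set of levels 0 and 1. *)
    have [] := @foster _ _ _ _ PN A (fun s => (- a)^-1 * f s)
      (level0 Se S1 ++ level Se S1 0) t At.
    - by move=> s'; exact: S0_from.
    - by move=> s'; rewrite mulr_ge0 ?lyapunov_ge0 // invr_ge0 oppr_ge0 ltW.
    - case=> [i|[[|x] i]]; rewrite mem_cat ?mem_level0 ?mem_level ?orbT // => _.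
      rewrite stepZ (lyapunov_drift wE) mulrDr lerD2l.
      by rewrite invrN mulNr mulVf // lt_eqF.
    by move=> V sumV; apply: (passage_finite chainZ PN) => n; exact: sumV.
  split=> [s S0s|s _]; first exact: (finite_passage [set s] s s).
  exact: (finite_passage S0 s s0).
have [j0 _] : exists j : S1, true by case/card_gt0P: S1_neq0 => j _; exists j.
have th0 : 0 <= escape_threshold w a.
  by have := escape_threshold_gt w a_gt0; have := W_ge0 w0; lra.
have [[c0 S0c0]|unbounded] := pselect (exists c, forall s, S0 s -> f s <= c).
  pose c := Num.max c0 (escape_threshold w a).
  have S0c s : S0 s -> f s <= c by move=> /S0c0; rewrite le_max => ->.
  (* Since [Num.bound c] exceeds [c] and [w] is nonnegative, [t] lies above all of [S0]. *)
  pose t : mmrrw_state Se S1 := inr (Num.bound c, j0).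
  have ct : c < f t.
    rewrite (lt_le_trans (archi_boundP _)) ?lerDl ?w0 //.
    by rewrite le_max th0 orbT.
  have thc : escape_threshold w a <= c by rewrite le_max lexx orbT.
  right; exists t; first by move=> /S0c; rewrite leNgt ct.
  have [e e0 et] := escape_positive w0 wE a_gt0 thc S0c ct.
  by have [] := escape_unstable chainZ PN e0 et.
(* Taking [c] at least [f s] puts the singleton of [s] below the bound. Escape is found at a higher
   [t] in [S0] and carried back to [s] by accessibility. *)
left=> s S0s; pose c := Num.max (f s) (escape_threshold w a).
have [t S0t ct] : exists2 t, S0 t & c < f t.
  apply: contrapT => nt; apply: unbounded; exists c => t S0t.
  by rewrite leNgt; apply/negP => ct; apply: nt; exists t.
have thc : escape_threshold w a <= c by rewrite le_max lexx orbT.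
have sc s' : [set s] s' -> f s' <= c by move=> ->; rewrite le_max lexx.
have [e e0 et] := escape_positive w0 wE a_gt0 thc sc ct.
have [e' e'0 es] := escape_accessible PN (S0_acc _ _ S0s S0t) e0 et.
by have [] := escape_unstable chainZ PN e'0 es.
Qed.
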